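(* For every $n\ge 6$ there exists no weakly symmetric subspace extension of the permutahedron $\Pi_n$ (with respect to the group $G=S_n$ acting on the vertices by permuting coordinates) with fewer than $\frac{n(n-1)}{2}$ variables; i.e. every weakly symmetric subspace extension $Q\subseteq\mathbb{R}^d$ of $\Pi_n$ satisfies $d\ge\frac{n(n-1)}{2}$.
   Context: The permutahedron $\Pi_n$ is the convex hull of all points of $\mathbb{R}^n$ obtained from $(1,2,\dots,n)$ by permuting coordinates; its vertex set is $X=\{(\zeta^{-1}(1),\dots,\zeta^{-1}(n)) : \zeta\in S_n\}$. The group $S_n$ acts on $\mathbb{R}^n$ by $(\pi.x)_v=x_{\pi^{-1}(v)}$, and $S_d$ acts on $\mathbb{R}^d$ by $(\varkappa.y)_j=y_{\varkappa^{-1}(j)}$. An extension of a polytope $P\subseteq\mathbb{R}^m$ is a polytope $Q\subseteq\mathbb{R}^d$ with a linear map $p:\mathbb{R}^d\to\mathbb{R}^m$ such that $p(Q)=P$; it is a subspace extension if $Q$ is the intersection of an affine subspace of $\mathbb{R}^d$ with the nonnegative orthant $\mathbb{R}^d_+$. A section is a map $s:X\to Q$ with $s(x)\in Q\cap p^{-1}(x)$ for all vertices $x\in X$ of $P$. The extension is weakly symmetric with respect to a group $G\subseteq S_m$ acting on $X$ if there is a section $s:X\to Q$ such that for every $\pi\in G$ there is $\varkappa_\pi\in S_d$ with $s(\pi.x)=\varkappa_\pi.s(x)$ for all $x\in X$. *)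

(* Defs.v *)
From HB Require Import structures.
From mathcomp Require Import all_boot all_order all_algebra all_fingroup.
From mathcomp Require Import reals.
Set Implicit Arguments. Unset Strict Implicit. Unset Printing Implicit Defensive.
Import Order.TTheory GRing.Theory Num.Theory.
Local Open Scope ring_scope.

Section Defs.
Variable R : realType.

Definition perm_act (m : nat) (pi : 'S_m) (x : 'rV[R]_m) : 'rV[R]_m :=
  \row_v x 0 ((pi^-1)%g v).

(* vertex of the permutahedron associated with zeta : (zeta^{-1}(1),...,zeta^{-1}(n)),
   shifted to 0-based indices: coordinate v is zeta^{-1}(v) + 1. *)
Definition perm_vertex (n : nat) (zeta : 'S_n) : 'rV[R]_n :=
  \row_v (((zeta^-1)%g v : nat).+1)%:R.

Definition perm_vertices (n : nat) (x : 'rV[R]_n) : Prop :=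
  exists zeta : 'S_n, x = perm_vertex zeta.

Definition permutahedron (n : nat) (x : 'rV[R]_n) : Prop :=
  exists lam : {ffun 'S_n -> R},
    (forall zeta, 0 <= lam zeta) /\ \sum_zeta lam zeta = 1 /\
    x = \sum_zeta lam zeta *: perm_vertex zeta.

Definition subspace_polyhedron (d k : nat) (A : 'M[R]_(d, k)) (b : 'rV[R]_k)
  (y : 'rV[R]_d) : Prop :=
  y *m A = b /\ forall i, 0 <= y 0 i.

Definition bounded_set (d : nat) (Q : 'rV[R]_d -> Prop) : Prop :=
  exists M : R, forall y, Q y -> forall i, `|y 0 i| <= M.

Definition subspace_extension (n d k : nat) (A : 'M[R]_(d, k)) (b : 'rV[R]_k)
  (P : 'M[R]_(d, n)) : Prop :=
  bounded_set (subspace_polyhedron A b) /\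
  (forall x, permutahedron x <->
     exists y, subspace_polyhedron A b y /\ x = y *m P).

Definition weakly_symmetric (n d k : nat) (A : 'M[R]_(d, k)) (b : 'rV[R]_k)
  (P : 'M[R]_(d, n)) : Prop :=
  exists s : 'rV[R]_n -> 'rV[R]_d,
    (forall x, perm_vertices x -> subspace_polyhedron A b (s x) /\ s x *m P = x) /\
    (forall pi : 'S_n, exists kappa : 'S_d,
       forall x, perm_vertices x -> s (perm_act pi x) = perm_act kappa (s x)).

End Defs.

(* Main.v *)
Require Import Defs.
From HB Require Import structures.
From mathcomp Require Import all_boot all_order all_algebra all_fingroup.
From mathcomp Require Import reals.
From mathcomp Require Import zify lra.
Import Order.TTheory GRing.Theory Num.Theory.
Set Implicit Arguments. Unset Strict Implicit. Unset Printing Implicit Defensive.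

(* For a coordinate j of the section, let Z_j be the set of permutations at
   which this coordinate vanishes. The family of the Z_j is stable under right
   translation and separates every facet {g | g maps the first k positions to
   themselves} from every vertex z off it: some Z_j contains the facet and misses
   z. For each k choose such a Z_k for an even z_k that exchanges k - 1 and k and
   otherwise respects the prefix, and let H be the stabilizer of Z_k. If the
   family has fewer than n(n-1)/2 members, then H has small index.
   If H is intransitive, it fixes a point v and contains every even permutation
   fixing v. On even permutations, membership in Z_k then depends only on the
   position of v, and k is the first, or k - 1 the last, position outside Z_k.
   Hence each n members of the family serve at most two values of k.
   If H is transitive, it does not contain the alternating group, and Bochert's
   bound together with an analysis of 3-cycles shows that its index is at least
   n(n-3)/2, or n = 6 and H is 2-transitive, which is impossible for k = 2.
   Since k = 1 requires an intransitive H, both kinds together need n(n-1)/2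
   members. *)

(** * Permutation groups of small index *)

Section PermutationGroups.
Local Open Scope group_scope.
Variable T : finType.
Implicit Types (G : {group {perm T}}) (A D : {set T}) (g h : {perm T}).

(** Products of permutations act from left to right, so on distinct points this is the cycle a -> b
    -> c -> a. *)
Definition cycle3 (a b c : T) : {perm T} := tperm a b * tperm a c.

Lemma cycle3J a b c g : cycle3 a b c ^ g = cycle3 (g a) (g b) (g c).
Proof. by rewrite /cycle3 conjMg !tpermJ. Qed.

Lemma cycle3V a b c : (cycle3 a b c)^-1 = cycle3 a c b.
Proof. by rewrite /cycle3 invMg !tpermV. Qed.

Lemma cycle3E1 a b c : b != c -> a != b -> cycle3 a b c a = b.
Proof. by move=> bc ab; rewrite permM tpermL tpermD // eq_sym. Qed.

Lemma cycle3E2 a b c : cycle3 a b c b = c.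
Proof. by rewrite permM tpermR tpermL. Qed.

Lemma cycle3E3 a b c : b != c -> a != c -> cycle3 a b c c = a.
Proof. by move=> bc ac; rewrite permM (tpermD ac bc) tpermR. Qed.

Lemma cycle3D a b c x : x != a -> x != b -> x != c -> cycle3 a b c x = x.
Proof. by move=> xa xb xc; rewrite permM !tpermD // eq_sym. Qed.

Lemma cycle3_rot a b c : b != c -> a != c -> a != b -> cycle3 b c a = cycle3 a b c.
Proof.
move=> bc ac ab; apply/permP=> x.
have [->|xa] := eqVneq x a; first by rewrite cycle3E1 ?cycle3E3 // eq_sym.
have [->|xb] := eqVneq x b; first by rewrite cycle3E1 ?cycle3E2 // eq_sym.
have [->|xc] := eqVneq x c; first by rewrite cycle3E3 ?cycle3E2 // eq_sym.
by rewrite !cycle3D.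
Qed.

(** The supports meet only in c, so h fixes [g c] and the preimage of c under g, and g fixes [h c]
    and the preimage of c under h. Tracing points gives c -> [h c] -> [g c] -> c; elsewhere each
    move is undone by its inverse. *)
Lemma commg_cycle3 g h c :
    g c != c -> h c != c -> (forall x, g x != x -> h x != x -> x = c) ->
  [~ g, h] = cycle3 c (h c) (g c).
Proof.
move=> gc hc gh.
have gV x : (g^-1 x == x) = (g x == x).
  by rewrite -(inj_eq (@perm_inj _ g)) permKV eq_sym.
have hV x : (h^-1 x == x) = (h x == x).
  by rewrite -(inj_eq (@perm_inj _ h)) permKV eq_sym.
have fixh x : x != c -> g x != x -> h x = x.
  by move=> xc gx; apply/eqP; apply: contraNT xc => hx; apply/eqP/gh.
have fixg x : x != c -> h x != x -> g x = x.
  by move=> xc hx; apply/eqP; apply: contraNT xc => gx; apply/eqP/gh.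
have fixhV x : x != c -> g x != x -> h^-1 x = x.
  by move=> xc gx; apply/eqP; rewrite hV fixh.
have fixgV x : x != c -> h x != x -> g^-1 x = x.
  by move=> xc hx; apply/eqP; rewrite gV fixg.
have gVm x : g x != x -> g (g^-1 x) != g^-1 x.
  by rewrite permKV -gV eq_sym.
have hVm x : h x != x -> h (h^-1 x) != h^-1 x.
  by rewrite permKV -hV eq_sym.
have ghc : h c != g c.
  apply/eqP=> e; have: h c = c; last by move/eqP; rewrite (negPf hc).
  by apply: gh; rewrite ?(inj_eq perm_inj) // e (inj_eq perm_inj).
apply/permP=> x; rewrite /commg /conjg 3!permM.
have [->|xc] := eqVneq x c.
  have e : h^-1 (g^-1 c) = g^-1 c by apply: fixhV; rewrite ?gV ?gVm.
  by rewrite e permKV cycle3E1 // eq_sym.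
have [->|xq] := eqVneq x (h c).
  have e : g^-1 (h c) = h c by apply: fixgV; rewrite ?(inj_eq perm_inj).
  have e' : h (g c) = g c by apply: fixh; rewrite ?(inj_eq perm_inj).
  by rewrite e permK e' cycle3E2.
have [->|xp] := eqVneq x (g c).
  have e : g (h^-1 c) = h^-1 c by apply: fixg; rewrite ?hV ?hVm.
  by rewrite permK e permKV cycle3E3 // eq_sym.
rewrite cycle3D //; have [gx|gx] := eqVneq (g x) x; last first.
  have e : h^-1 (g^-1 x) = g^-1 x.
    by apply: fixhV; rewrite ?gVm // -(inj_eq (@perm_inj _ g)) permKV.
  by rewrite e permKV; apply: fixh.
have -> : g^-1 x = x by rewrite -{1}gx permK.
have [hx|hx] := eqVneq (h x) x.
  have -> : h^-1 x = x by rewrite -{1}hx permK.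
  by rewrite gx.
have e : g (h^-1 x) = h^-1 x.
  by apply: fixg; rewrite ?hVm // -(inj_eq (@perm_inj _ h)) permKV.
by rewrite e permKV.
Qed.

Definition has_cycle3 G := [exists a, exists b, exists c,
  [&& uniq [:: a; b; c] & cycle3 a b c \in G]].

Lemma has_cycle3I G a b c :
  a != b -> a != c -> b != c -> cycle3 a b c \in G -> has_cycle3 G.
Proof.
move=> ab ac bc abcG; apply/existsP; exists a; apply/existsP; exists b.
by apply/existsP; exists c; rewrite /= !inE negb_or ab ac bc abcG.
Qed.

(** * Groups supported on a set D, and Bochert's bound *)

Lemma Sym_setP D g : reflect (forall x, x \notin D -> g x = x) (g \in Sym D).
Proof.
rewrite inE; apply: (iffP subsetP) => [gD x xD|gD x].
  by apply/eqP; apply: contraNT xD => gx; apply: gD; rewrite inE.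
by rewrite !inE; apply: contraR => /gD ->.
Qed.

Lemma Sym_closed D g x : g \in Sym D -> (g x \in D) = (x \in D).
Proof. by rewrite inE => /perm_closed. Qed.

Lemma nontrivial_moved g : g != 1 -> exists x, g x != x.
Proof.
move=> g1; apply/existsP; apply: contraNT g1; rewrite negb_exists.
by move=> /forallP fix_g; apply/eqP/permP=> x; rewrite perm1; apply/eqP/negPn.
Qed.

(* Bochert: if Delta is a largest set on which G has no nontrivial element and
   its complement is larger, both the complement and Delta plus one point
   carry an element of G; the commutator of the two is a 3-cycle. *)
Lemma Bochert_trivial_set G D : ~~ has_cycle3 G ->
  exists2 A : {set T}, A \subset D & (#|D| <= #|A|.*2)%N /\ G :&: Sym A = 1.
Proof.
move=> no3; pose P A := (A \subset D) && (G :&: Sym A == 1).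
have P0 : P set0.
  rewrite /P sub0set; apply/eqP/setP=> g; rewrite !inE.
  apply/andP/eqP=> [[_ g0]|->]; last by rewrite group1 perm_on1.
  by apply/permP=> x; rewrite perm1 (out_perm g0) // inE.
have [A /andP[sAD /eqP tA] maxA] := @arg_maxnP _ set0 P (fun A : {set T} => #|A|) P0.
exists A => //; split=> //; rewrite leqNgt; apply/negP => ltA.
have PB (B : {set T}) : B \subset D -> (#|A| < #|B|)%N ->
    exists2 g, g \in G :&: Sym B & g != 1.
  move=> sBD; rewrite ltnNge => AB.
  have /trivgPn[g gG g1] : G :&: Sym B != 1.
    by apply: contraNneq AB => tB; apply: maxA; rewrite /P sBD tB eqxx.
  by exists g.
have [||g /setIP[gG gS] /nontrivial_moved[c gc]] := PB (D :\: A).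
- exact: subsetDl.
- by have := cardsID A D; rewrite (setIidPr sAD); lia.
have cDA : c \in D :\: A.
  by apply: contraNT gc => /(Sym_setP _ _ gS) ->.
have [cA cD] : c \notin A /\ c \in D by move: cDA; rewrite inE => /andP[].
have [||h /setIP[hG hS] h1] := PB (c |: A).
- by rewrite subUset sub1set cD.
- by rewrite cardsU1 cA.
have hc : h c != c.
  apply: contra_neq h1 => hc; apply/set1gP; rewrite -tA inE hG.
  apply/Sym_setP => x xA; have [->//|xc] := eqVneq x c.
  by apply: (Sym_setP _ _ hS); rewrite !inE negb_or xc.
have comm : forall x, g x != x -> h x != x -> x = c.
  move=> x gx hx; have xDA : x \in D :\: A.
    by apply: contraNT gx => /(Sym_setP _ _ gS) ->.
  have : x \in c |: A by apply: contraNT hx => /(Sym_setP _ _ hS) ->.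
  by move: xDA; rewrite !inE => /andP[/negPf-> _]; rewrite orbF => /eqP.
case/negP: no3; apply: (@has_cycle3I G c (h c) (g c)).
- by rewrite eq_sym.
- by rewrite eq_sym.
- apply/eqP=> e; have: h c = c; last by move/eqP; rewrite (negPf hc).
  by apply: comm; rewrite ?(inj_eq perm_inj) // e (inj_eq perm_inj).
- by rewrite -commg_cycle3 // groupR.
Qed.

Lemma SymS A D : A \subset D -> Sym A \subset Sym D.
Proof.
move=> sAD; apply/subsetP=> g; rewrite !inE => /subsetP gA.
by apply/subsetP=> x /gA /(subsetP sAD).
Qed.

(** G meets [Sym A] trivially, so the product set of the two has |G| |A|! elements, all inside
    [Sym D]. *)
Lemma Bochert_bound G D : G \subset Sym D -> ~~ has_cycle3 G ->
  exists2 t, (#|D| <= t.*2)%N & (#|G| * t`! <= #|D|`!)%N.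
Proof.
move=> sGD /(Bochert_trivial_set D)[A sAD [leDA tA]]; exists #|A| => //.
have := TI_cardMg tA; rewrite card_Sym => <-; rewrite -(card_Sym D).
by apply: subset_leq_card; rewrite mul_subG // SymS.
Qed.

(** Restriction to A and to its complement in D embeds G into [Sym A] times [Sym (D :\: A)]. *)
Lemma card_acts_bin G A D :
    G \subset Sym D -> A \subset D -> [acts G, on A | 'P] ->
  (#|G| * 'C(#|D|, #|A|) <= #|D|`!)%N.
Proof.
move=> sGD sAD nAG; have leAD := subset_leq_card sAD.
rewrite -(bin_fact leAD) mulnC leq_pmul2l ?bin_gt0 //.
have nDG : [acts G, on D | 'P].
  apply/subsetP=> g gG; rewrite !inE /=; apply/subsetP=> x xD; rewrite !inE /=.
  by rewrite /aperm Sym_closed // (subsetP sGD).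
have nDAG := actsD nDG nAG.
have -> : (#|D| - #|A|)%N = #|D :\: A|.
  by rewrite cardsD (setIidPr sAD).
rewrite -!card_Sym -cardsX.
pose f g := (restr_perm A g, restr_perm (D :\: A) g).
have fI : {in G &, injective f}.
  move=> g h gG hG [eA eD]; apply/permP=> x.
  have [xA|xA] := boolP (x \in A).
    by rewrite -(restr_permE (subsetP nAG g gG)) // eA restr_permE // (subsetP nAG).
  have [xD|xD] := boolP (x \in D).
    have xDA : x \in D :\: A by rewrite inE xA.
    rewrite -(restr_permE (subsetP nDAG g gG)) // eD restr_permE //.
    exact: (subsetP nDAG).
  by rewrite !(Sym_setP _ _ (subsetP sGD _ _)).
rewrite -(card_in_imset fI); apply: subset_leq_card.
by apply/subsetP=> _ /imsetP[g gG ->]; rewrite !inE /= !restr_perm_on.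
Qed.

Lemma transitive_SymI G D : D != set0 ->
    (forall x y, x \in D -> y \in D -> exists2 g, g \in G & g x = y) ->
    G \subset Sym D ->
  [transitive G, on D | 'P].
Proof.
move=> /set0Pn[x xD] trG sGD; apply/imsetP; exists x => //.
apply/setP=> y; apply/idP/orbitP=> [yD|[g gG <-]].
  by have [g gG gx] := trG x y xD yD; exists g.
by rewrite /= /aperm Sym_closed // (subsetP sGD).
Qed.

Lemma acts_orbit_Sym G D x : G \subset Sym D -> x \in D ->
  orbit 'P G x \subset D.
Proof.
move=> sGD xD; apply/subsetP=> y /orbitP[g gG <-].
by rewrite /= /aperm Sym_closed // (subsetP sGD).
Qed.

Lemma trans_witness G D x y : [transitive G, on D | 'P] -> x \in D -> y \in D ->
  exists2 g, g \in G & g x = y.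
Proof.
move=> trG xD; rewrite -(atransP trG x xD) => /orbitP[g gG <-].
by exists g.
Qed.

Lemma trans_card_stab G D x : [transitive G, on D | 'P] -> x \in D ->
  #|G| = (#|D| * #|'C_G[x | 'P]|)%N.
Proof. by move=> trG xD; rewrite -(card_orbit_stab 'P G x) (atransP trG x xD). Qed.

Lemma stab_subSym G D x : G \subset Sym D -> 'C_G[x | 'P] \subset Sym (D :\ x).
Proof.
move=> sGD; apply/subsetP=> g /setIP[gG /astab1P gx].
apply/Sym_setP=> y; rewrite !inE negb_and negbK => /orP[/eqP->//|].
by apply: (Sym_setP _ _ (subsetP sGD g gG)).
Qed.

(** Lying on a common 3-cycle of G, made reflexive. This is an equivalence whose classes G permutes,
    and G contains every 3-cycle within a class. *)
Definition rel3 G a b :=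
  (a == b) || [exists c, [&& a != b, a != c, b != c & cycle3 a b c \in G]].

Lemma rel3P G a b : a != b ->
  reflect (exists c, [/\ a != c, b != c & cycle3 a b c \in G]) (rel3 G a b).
Proof.
move=> ab; rewrite /rel3 (negPf ab) /=; apply: (iffP existsP) => -[c].
  by move=> /and3P[ac bc abcG]; exists c.
by case=> ac bc abcG; exists c; rewrite ac bc.
Qed.

Lemma rel3_refl G a : rel3 G a a.
Proof. by rewrite /rel3 eqxx. Qed.

Lemma rel3_sym G a b : rel3 G a b = rel3 G b a.
Proof.
have [->//|ab] := eqVneq a b; have ba : b != a by rewrite eq_sym.
by apply/rel3P/rel3P => // -[c [ac bc abcG]]; exists c; split=> //;
  rewrite -groupV cycle3V cycle3_rot // eq_sym.
Qed.

Lemma rel3J G a b g : g \in G -> rel3 G a b -> rel3 G (g a) (g b).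
Proof.
move=> gG; have [->|ab] := eqVneq a b; first by rewrite !rel3_refl.
case/(rel3P _ ab) => c [ac bc abcG].
apply/rel3P; first by rewrite (inj_eq perm_inj).
by exists (g c); rewrite !(inj_eq perm_inj) -cycle3J groupJ.
Qed.

(** Conjugating (a b d) by (b c e) replaces b by c and keeps a, unless a = e or c = d; in those
    cases one of the two given cycles already contains a and c. *)
Lemma rel3_trans G a b c : rel3 G a b -> rel3 G b c -> rel3 G a c.
Proof.
have [->//|ab] := eqVneq a b; have [->//|bc] := eqVneq b c.
have [->|ac] := eqVneq a c; first by rewrite rel3_refl.
case/(rel3P _ ab) => d [ad bd abdG] /(rel3P _ bc)[e [be ce bceG]].
have [ae|ae] := eqVneq a e.
  apply/rel3P=> //; exists b; rewrite ab eq_sym bc -groupV cycle3V; split=> //.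
  by rewrite -cycle3_rot // ae.
have [cd|cd] := eqVneq c d.
  apply/rel3P=> //; exists b; rewrite ab eq_sym bc -groupV cycle3V; split=> //.
  by rewrite cd.
have := groupJ abdG bceG; rewrite cycle3J (cycle3D ab ac ae) (cycle3E1 ce bc).
set f := cycle3 b c e => afdG.
apply/rel3P=> //; exists (f d); split=> //.
- by rewrite -(cycle3D ab ac ae) (inj_eq perm_inj).
- by rewrite -[c in c != _](cycle3E1 ce bc) (inj_eq perm_inj).
Qed.

(** Take (a b x) in G. If x is not c, then x and c are related through a, so G contains some (x c
    z), and conjugating by it turns (a b x) into (a b c). When z is a or b, further conjugations
    among these cycles lead to the same end. *)
Lemma rel3_cycle3 G a b c : a != b -> a != c -> b != c ->
  rel3 G a b -> rel3 G a c -> cycle3 a b c \in G.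
Proof.
move=> ab ac bc Rab Rac; have /(rel3P _ ab)[x [ax bx abxG]] := Rab.
have [->//|cx] := eqVneq c x; have xc : x != c by rewrite eq_sym.
have ba : b != a by rewrite eq_sym.
have ca : c != a by rewrite eq_sym.
have cb : c != b by rewrite eq_sym.
have xa : x != a by rewrite eq_sym.
have xb : x != b by rewrite eq_sym.
have bxaG : cycle3 b x a \in G by rewrite cycle3_rot.
have xabG : cycle3 x a b \in G by rewrite -cycle3_rot.
have axbG : cycle3 a x b \in G by rewrite -groupV cycle3V.
have : rel3 G x c.
  by apply: rel3_trans Rac; apply/rel3P=> //; exists b.
case/(rel3P _ xc)=> z [xz cz xczG].
have [za|za] := eqVneq z a.
  rewrite za in xczG.
  have := groupJ abxG xczG.
  rewrite cycle3J cycle3E3 ?(cycle3D bx bc ba) ?cycle3E1 // => xbcG.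
  have := groupJ xbcG axbG.
  rewrite cycle3J cycle3E2 cycle3E3 ?(cycle3D ca cx cb) // => bacG.
  by rewrite -groupV cycle3V cycle3_rot.
have [zb|zb] := eqVneq z b.
  rewrite zb in xczG.
  have := groupJ abxG xczG.
  rewrite cycle3J cycle3E3 ?(cycle3D ax ac ab) ?cycle3E1 // => axcG.
  have := groupJ axcG axbG.
  rewrite cycle3J cycle3E2 cycle3E1 ?(cycle3D ca cx cb) // => xbcG.
  have := groupJ xbcG axbG.
  rewrite cycle3J cycle3E2 cycle3E3 ?(cycle3D ca cx cb) // => bacG.
  by rewrite -groupV cycle3V cycle3_rot.
have := groupJ abxG xczG.
by rewrite cycle3J cycle3E1 // !cycle3D // eq_sym.
Qed.

Lemma even_in_of_cycle3 G D :
    (2 < #|D|)%N ->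
    (forall a b c, a \in D -> b \in D -> c \in D ->
      a != b -> a != c -> b != c -> cycle3 a b c \in G) ->
  forall g, g \in Sym D -> ~~ odd_perm g -> g \in G.
Proof.
move=> D3 c3G.
have share a b c : a \in D -> b \in D -> c \in D -> a != b -> a != c ->
    tperm a b * tperm a c \in G.
  move=> aD bD cD ab ac; have [->|bc] := eqVneq b c; first by rewrite tperm2.
  exact: c3G.
have pair a b c d : a \in D -> b \in D -> c \in D -> d \in D ->
    a != b -> c != d -> tperm a b * tperm c d \in G.
  move=> aD bD cD dD ab cd; have [ac|ac] := eqVneq a c.
    by subst c; apply: share.
  have -> : tperm a b * tperm c d
           = (tperm a b * tperm a c) * (tperm c a * tperm c d).
    by rewrite [tperm c a]tpermC -mulgA (mulgA (tperm a c)) tperm2 mul1g.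
  by rewrite groupM ?share // eq_sym.
have [a0 [b0 [a0D b0D ab0]]] : exists a b, [/\ a \in D, b \in D & a != b].
  by apply/card_gt1P/ltnW.
(* Induction on the number of moved points, removing one transposition at a time. Odd permutations
   occur on the way; the fixed transposition of [a0] and [b0] corrects their parity. *)
suff claim m g : (#|[set x | g x != x]| <= m)%N -> g \in Sym D ->
    (if odd_perm g then g * tperm a0 b0 else g) \in G.
  by move=> g gD even_g; have := claim _ g (leqnn _) gD; rewrite (negPf even_g).
elim: m g => [|m IHm] g.
  rewrite leqn0 cards_eq0 => /eqP g0 _.
  have -> : g = 1.
    apply/permP=> x; rewrite perm1; apply/eqP; rewrite -[_ == _]negbK.
    by have := in_set0 x; rewrite -g0 inE => ->.
  by rewrite odd_perm1 group1.
move=> lt_g gD; have [->|/nontrivial_moved[x gx]] := eqVneq g 1.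
  by rewrite odd_perm1 group1.
have xD : x \in D by apply: contraNT gx => /(Sym_setP _ _ gD) ->.
have gxD : g x \in D by rewrite (Sym_closed _ gD).
have xgx : x != g x by rewrite eq_sym.
pose g' := g * tperm x (g x).
have g'D : g' \in Sym D.
  apply/Sym_setP=> y yD; rewrite permM (Sym_setP _ _ gD y yD) tpermD //.
    by apply: contraNneq yD => <-.
  by apply: contraNneq yD => <-.
have /IHm/(_ g'D) : (#|[set y | g' y != y]| <= m)%N.
  rewrite -ltnS; apply: leq_trans lt_g; apply: proper_card.
  apply/properP; split; last first.
    by exists x; rewrite !inE // permM tpermR eqxx.
  apply/subsetP=> y; rewrite !inE; apply: contra => /eqP gy.
  rewrite permM gy tpermD //; first by apply: contraNneq gx => ->; rewrite gy.
  by apply: contraNneq gx => gxy; rewrite -(inj_eq (@perm_inj _ g)) gxy gy.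
have -> : odd_perm g' = ~~ odd_perm g.
  by rewrite odd_permM odd_tperm xgx addbT.
have gE : g = g' * tperm x (g x) by rewrite -mulgA tperm2 mulg1.
case: (odd_perm g) => /= g'G; rewrite gE.
  by rewrite -mulgA groupM // pair.
have -> : g' * tperm x (g x)
        = (g' * tperm a0 b0) * (tperm a0 b0 * tperm x (g x)).
  by rewrite -[RHS]mulgA (mulgA (tperm a0 b0)) tperm2 mul1g.
by rewrite groupM // pair.
Qed.

(** Let B be the [rel3] class of a point x on a 3-cycle. If B is all of D, every 3-cycle on D lies
    in G. Otherwise an element moving x out of B takes B to a disjoint class, so 2 |B| <= |D|, and
    the stabilizer of x preserves B minus x, which gives the binomial bound. *)
Lemma cycle3_trans_dichotomy G D :
    G \subset Sym D -> [transitive G, on D | 'P] -> has_cycle3 G ->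
  (forall g, g \in Sym D -> ~~ odd_perm g -> g \in G) \/
  (exists b, [/\ (2 < b)%N, (b.*2 <= #|D|)%N
               & (#|G| * 'C(#|D|.-1, b.-1) <= #|D|`!)%N]).
Proof.
move=> sGD trG /existsP[x /existsP[y /existsP[z]]].
rewrite /= !inE negb_or => /andP[/and3P[/andP[xy xz] yz _] xyzG].
have movD a g : g \in G -> g a != a -> a \in D.
  by move=> gG; apply: contraNT => /(Sym_setP _ _ (subsetP sGD _ gG)) ->.
have xD : x \in D by apply: movD xyzG _; rewrite cycle3E1 // eq_sym.
have relD a b : a \in D -> rel3 G a b -> b \in D.
  have [->//|ab] := eqVneq a b => _ /(rel3P _ ab)[c [_ bc abcG]].
  by apply: movD abcG _; rewrite cycle3E2 eq_sym.
pose B := [set u | rel3 G x u].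
have sBD : B \subset D by apply/subsetP=> u; rewrite inE; apply: relD.
have xB : x \in B by rewrite inE rel3_refl.
have yB : y \in B by rewrite inE; apply/rel3P=> //; exists z.
have zB : z \in B.
  rewrite inE; apply/rel3P=> //; exists y.
  by rewrite xy eq_sym yz -groupV cycle3V.
have B3 : (2 < #|B|)%N.
  by apply/card_gt2P; exists x, y, z; split; split; rewrite // eq_sym.
have [BD|/subsetPn[u uD uB]] := boolP (D \subset B).
  left; apply: even_in_of_cycle3.
    by rewrite (leq_trans B3) // subset_leq_card.
  move=> a b c /(subsetP BD) aB /(subsetP BD) bB /(subsetP BD) cB ab ac bc.
  move: aB bB cB; rewrite !inE [rel3 G x a]rel3_sym => ax xb xc.
  by apply: rel3_cycle3 => //; apply: rel3_trans ax _.
right; exists #|B|; split=> //.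
  have [g gG gx] := trans_witness trG xD uD.
  rewrite -addnn -[X in (_ + X)%N](card_imset _ (@perm_inj _ g)).
  have /eqP <- : #|B :|: [set g v | v in B]| == (#|B| + #|[set g v | v in B]|)%N.
    rewrite (leq_card_setU _ _) -setI_eq0; apply/eqP/setP=> v; rewrite !inE.
    apply/negP=> /andP[xv /imsetP[w]]; rewrite inE => xw vE.
    case/negP: uB; rewrite inE (rel3_trans xv) // -gx vE rel3_sym.
    exact: rel3J.
  apply: subset_leq_card; rewrite subUset sBD; apply/subsetP=> _ /imsetP[v vB ->].
  by rewrite (Sym_closed _ (subsetP sGD _ gG)) (subsetP sBD).
rewrite (trans_card_stab trG xD) -mulnA.
have -> : (#|D|`! = #|D| * (#|D|.-1)`!)%N.
  by rewrite (cardsD1 x D) xD factS.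
rewrite leq_mul2l; apply/orP; right.
have -> : #|D|.-1 = #|D :\ x| by rewrite (cardsD1 x D) xD.
have -> : #|B|.-1 = #|B :\ x| by rewrite (cardsD1 x B) xB.
apply: card_acts_bin; first exact: stab_subSym.
  exact: setSD.
apply/subsetP=> g /setIP[gG /astab1P gx]; rewrite !inE /=.
apply/subsetP=> v; rewrite !inE /= /aperm => /andP[vx xv].
rewrite /= /aperm in gx.
by rewrite -[X in _ != X]gx (inj_eq perm_inj) vx -[X in rel3 _ X _]gx rel3J.
Qed.

(** * Numerical index bounds *)

Lemma leq_bin1 n k : (0 < k < n)%N -> (n <= 'C(n, k))%N.
Proof.
elim: n k => [|n IHn] [|k] // /andP[_]; rewrite ltnS => ltkn.
rewrite binS; have [->|k0] := posnP k; first by rewrite bin1 bin0 addn1.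
have [kn|nk] := ltnP k.+1 n.
  by have := IHn k.+1 kn; have : (0 < 'C(n, k))%N by [rewrite bin_gt0; lia]; lia.
have -> : k.+1 = n by lia.
by rewrite binn add1n ltnS IHn // k0.
Qed.

Lemma leq_bin2 n k : (1 < k)%N -> (k.+1 < n)%N -> ('C(n, 2) <= 'C(n, k))%N.
Proof.
elim: n k => [|n IHn] [|k] // k1 ltkn.
have [->//|k2] := eqVneq k 1%N.
rewrite [leqLHS]binS [leqRHS]binS bin1.
have [kn|nk] := ltnP k.+2 n; last first.
  have -> : n = k.+2 by lia.
  have -> : 'C(k.+2, k) = 'C(k.+2, 2) 
    by rewrite -bin_sub; [have -> : k.+2 - k = 2 by lia | lia].
  by rewrite binSn addnC.
by rewrite leq_add ?IHn ?leq_bin1 //; lia.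
Qed.

(** The index is below |D| / 2. Without 3-cycles it would be at least t! with 2t >= |D|; an
    intransitive group would have index at least |D|, and a proper class of 3-cycles would force at
    least |D| - 1. *)
Lemma small_index_even G D :
    G \subset Sym D -> (#|D|`!.*2 < #|D| * #|G|)%N ->
  forall g, g \in Sym D -> ~~ odd_perm g -> g \in G.
Proof.
move=> sGD lt_idx.
have D0 : (0 < #|D|)%N by move: lt_idx; case: #|D|.
have /card_gt0P[x xD] := D0.
have has3 : has_cycle3 G.
  apply: contraLR lt_idx => /(Bochert_bound sGD)[t le_t le_G].
  rewrite -leqNgt -muln2 (leq_trans (leq_mul le_t (leqnn _))) //.
  rewrite -muln2 mulnAC leq_mul2r /= mulnC (leq_trans _ le_G) //.
  by rewrite leq_mul2l fact_geq orbT.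
have trG : [transitive G, on D | 'P].
  apply/imsetP; exists x => //; apply/eqP; rewrite eqEsubset acts_orbit_Sym // andbT.
  apply: contraLR lt_idx => nsub.
  set A := orbit 'P G x in nsub; have sAD : A \subset D by apply: acts_orbit_Sym.
  have := card_acts_bin sGD sAD (acts_orbit 'P x (subsetT G)).
  have : (#|D| <= 'C(#|D|, #|A|))%N.
    apply: leq_bin1; apply/andP; split.
      by apply/card_gt0P; exists x; apply: orbit_refl.
    by apply: proper_card; rewrite properE sAD.
  rewrite -(leq_pmul2l (cardG_gt0 G)) => le1 le2.
  by rewrite -leqNgt mulnC (leq_trans le1) // (leq_trans le2) // -addnn leq_addr.
have [//|[b [b3 bD leG]]] := cycle3_trans_dichotomy sGD trG has3.
have : (#|D|.-1 <= 'C(#|D|.-1, b.-1))%N by apply: leq_bin1; lia.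
rewrite -(leq_pmul2l (cardG_gt0 G)) => le1; have := leq_trans le1 leG.
by move: lt_idx; case: #|D| b3 bD {le1 leG} => [|m] /=; nia.
Qed.

Lemma transitive_not_even_bound G D :
    G \subset Sym D -> [transitive G, on D | 'P] -> (5 < #|D|)%N ->
    ~ (forall g, g \in Sym D -> ~~ odd_perm g -> g \in G) ->
  (#|G| * 'C(#|D|.-1, 2) <= #|D|`!)%N \/
  ~~ has_cycle3 G /\ exists2 t, (#|D| <= t.*2)%N & (#|G| * t`! <= #|D|`!)%N.
Proof.
move=> sGD trG D6 notAlt.
have [has3|no3] := boolP (has_cycle3 G); last first.
  by right; split=> //; apply: Bochert_bound.
left; have [//|[b [b3 bD leG]]] := cycle3_trans_dichotomy sGD trG has3.
apply: leq_trans leG; rewrite leq_mul2l leq_bin2 ?orbT //; lia.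
Qed.

(** It suffices that t (2t - 3) <= t!. This starts at t = 4 and fails at t = 3, which is why n = 6
    is treated separately. *)
Lemma fact_ge_quadratic n t : (6 < n)%N -> (n <= t.*2)%N ->
  (n * (n - 3) <= t`!.*2)%N.
Proof.
move=> n7 nt; have t4 : (3 < t)%N by lia.
suff : (t * (2 * t - 3) <= t`!)%N by nia.
elim: t t4 {n n7 nt} => // t IHt; rewrite ltnS leq_eqVlt => /orP[/eqP<-//|t4].
by have := IHt t4; rewrite factS; nia.
Qed.

Lemma transitive_index_bound G D :
    G \subset Sym D -> [transitive G, on D | 'P] -> (6 < #|D|)%N ->
    ~ (forall g, g \in Sym D -> ~~ odd_perm g -> g \in G) ->
  (#|G| * (#|D| * (#|D| - 3)) <= #|D|`!.*2)%N.
Proof.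
move=> sGD trG D7 notAlt.
have [leG|[_ [t le_t leG]]] := transitive_not_even_bound sGD trG (ltnW D7) notAlt.
  rewrite -(leq_double) in leG; apply: leq_trans leG.
  rewrite -muln2 -mulnA leq_mul2l; apply/orP; right.
  have /= := bin_ffact #|D|.-1 2; rewrite ffactnS ffactn1 (_ : 2`! = 2) // => ->.
  by case: #|D| D7 => [|[|[|m]]] //= _; nia.
have := fact_ge_quadratic D7 le_t; rewrite -(leq_pmul2l (cardG_gt0 G)) => le1.
by rewrite (leq_trans le1) // -doubleMr leq_double.
Qed.

Lemma transitive6_index_ge6 G D :
    G \subset Sym D -> [transitive G, on D | 'P] -> #|D| = 6 ->
    ~ (forall g, g \in Sym D -> ~~ odd_perm g -> g \in G) ->
  (#|G| * 6 <= 6`!)%N.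
Proof.
move=> sGD trG D6 notAlt.
have [|leG|[_ [t le_t leG]]] := transitive_not_even_bound sGD trG _ notAlt.
- by rewrite D6.
- by rewrite D6 /= in leG; apply: leq_trans leG; rewrite leq_mul2l orbT.
- rewrite D6 in le_t leG; apply: leq_trans leG; rewrite leq_mul2l.
  by apply/orP; right; apply: (@leq_fact 3); lia.
Qed.

(** A 3-cycle would force index at least 10, so there is none. If the stabilizer K of x is
    intransitive on the other five points, orbits of size 2 or 3 again give index at least 10, so K
    fixes a further point z. Its index then forces K to be the full symmetric group on four points,
    which contains 3-cycles. *)
Lemma transitive6_2trans G D x :
    G \subset Sym D -> [transitive G, on D | 'P] -> #|D| = 6 ->
    ~ (forall g, g \in Sym D -> ~~ odd_perm g -> g \in G) ->
    (6`! < #|G| * 9)%N -> x \in D ->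
  [transitive 'C_G[x | 'P], on D :\ x | 'P].
Proof.
move=> sGD trG D6 notAlt idx xD.
have [|leG|[no3 _]] := transitive_not_even_bound sGD trG _ notAlt.
- by rewrite D6.
- by rewrite D6 (_ : 'C(6.-1, 2) = 10) // in leG; lia.
pose K := 'C_G[x | 'P]%G.
have sKD : K \subset Sym (D :\ x) := stab_subSym x sGD.
have cardG : #|G| = (6 * #|K|)%N by rewrite (trans_card_stab trG xD) D6.
have DX : #|D :\ x| = 5 by have := cardsD1 x D; rewrite xD D6; case.
have /card_gt0P[y yD] : (0 < #|D :\ x|)%N by rewrite DX.
apply/imsetP; exists y => //; apply/eqP; rewrite eqEsubset acts_orbit_Sym // andbT.
apply/negP=> /negP nsub.
set A := orbit 'P K y in nsub; have sAD : A \subset D :\ x by apply: acts_orbit_Sym.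
have idxK : (5`! < #|K| * 9)%N by move: idx; rewrite cardG factS -mulnA ltn_pmul2l.
have bnd (B : {set T}) : B \subset D :\ x -> [acts K, on B | 'P] -> #|B| \in [:: 2; 3] -> False.
  move=> sB aB; have := card_acts_bin sKD sB aB; rewrite DX !inE.
  move=> le5 B23; have {B23} E : 'C(5, #|B|) = 10 by case/orP: B23 => /eqP->.
  have le9 : (#|K| * 9 <= #|K| * 10)%N by rewrite leq_mul2l orbT.
  by rewrite E in le5; have := leq_trans idxK (leq_trans le9 le5); rewrite ltnn.
have A1 : (0 < #|A|)%N by apply/card_gt0P; exists y; apply: orbit_refl.
have A5 : (#|A| < 5)%N by rewrite -DX; apply: proper_card; rewrite properE sAD.
have aA : [acts K, on A | 'P] := acts_orbit 'P y (subsetT K).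
have aDx : [acts K, on D :\ x | 'P].
  apply/subsetP=> g gK; rewrite !inE /=; apply/subsetP=> z zD; rewrite !inE /=.
  by rewrite /aperm -in_setD1 (Sym_closed _ (subsetP sKD _ gK)).
have [z zD fixz] : exists2 z, z \in D :\ x & [acts K, on [set z] | 'P].
  have [A1'|A1'] := eqVneq #|A| 1%N.
    have /cards1P[z zE] : #|A| == 1%N by rewrite A1'.
    by exists z; rewrite ?(subsetP sAD) ?zE ?inE // -zE.
  have A4 : #|A| = 4.
    have := bnd A sAD aA; rewrite !inE.
    by move: A1 A1' A5; clear; case: #|A| => [|[|[|[|[|]]]]] // _ _ _ [].
  have : #|(D :\ x) :\: A| == 1%N by rewrite cardsD (setIidPr sAD) DX A4.
  case/cards1P=> z zE; exists z; last by rewrite -zE actsD.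
  by have := set11 z; rewrite -zE inE => /andP[].
have sKz : K \subset Sym (D :\ x :\ z).
  apply/subsetP=> g gK; apply/Sym_setP=> v; rewrite in_setD1 negb_and negbK.
  case/orP=> [/eqP->|]; last exact: (Sym_setP _ _ (subsetP sKD _ gK)).
  have := subsetP fixz g gK; rewrite !inE /= sub1set !inE /= /aperm.
  by move/eqP.
have DXZ : #|D :\ x :\ z| = 4 by have := cardsD1 z (D :\ x); rewrite zD DX; case.
have KE : K = Sym (D :\ x :\ z) :> {set _}.
  apply/eqP; rewrite eqEcard sKz card_Sym DXZ.
  have := cardSg sKz; rewrite card_Sym DXZ => /dvdnP[q qE].
  have q9 : (5 * q < 9)%N.
    by rewrite -(ltn_pmul2r (cardG_gt0 K)) -mulnA -qE [(9 * _)%N]mulnC.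
  have q0 : (0 < q)%N by move: (fact_gt0 4); rewrite qE; case: (q).
  have q1 : q = 1%N by move: q0 q9; clear; lia.
  by rewrite qE q1 mul1n leqnn.
have /card_gt2P[a [b [c [[aD bD cD] [ab bc ca]]]]] : (2 < #|D :\ x :\ z|)%N.
  by rewrite DXZ.
case/negP: no3; apply: (@has_cycle3I G a b c) => //; first by rewrite eq_sym.
have : cycle3 a b c \in K.
  rewrite KE; apply/Sym_setP=> v vD; rewrite cycle3D //;
  by apply: contraNneq vD => ->.
by case/setIP.
Qed.

(** An orbit of size other than 1 and |T| - 1 would give index at least 'C(|T|, 2). So some point v
    is fixed, and inside the symmetric group on the remaining points the index is small enough for
    [small_index_even]. *)
Lemma intransitive_fixed_point G :
    (#|T|`!.*2 < #|T| * (#|T| - 1) * #|G|)%N ->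
    ~~ [transitive G, on [set: T] | 'P] ->
  exists v, (forall g, g \in G -> g v = v) /\
            (forall g, g v = v -> ~~ odd_perm g -> g \in G).
Proof.
move=> idx ntr; have sGT : G \subset Sym [set: T].
  by apply/subsetP=> g _; apply/Sym_setP=> x; rewrite inE.
have T0 : (0 < #|[set: T]|)%N by rewrite cardsT; move: idx; case: #|T|.
have /card_gt0P[x _] := T0.
set A := orbit 'P G x; have aA : [acts G, on A | 'P] := acts_orbit 'P x (subsetT G).
have A0 : (0 < #|A|)%N by apply/card_gt0P; exists x; apply: orbit_refl.
have AT : (#|A| < #|T|)%N.
  rewrite -cardsT proper_card // properT; apply: contraNneq ntr => AE.
  by rewrite -AE; apply/imsetP; exists x; rewrite ?AE.
have acts1 v : [acts G, on [set v] | 'P] -> forall g, g \in G -> g v = v.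
  move=> av g gG; have := subsetP av g gG.
  by rewrite !inE /= sub1set !inE /= /aperm => /eqP.
have aT : [acts G, on [set: T] | 'P].
  by apply/subsetP=> g _; rewrite !inE /=; apply/subsetP=> y _; rewrite !inE.
have [v fixv] : exists v, forall g, g \in G -> g v = v.
  have [A1|A1] := eqVneq #|A| 1%N.
    have /cards1P[v vE] : #|A| == 1%N by rewrite A1.
    by exists v; apply: acts1; rewrite -vE.
  have [A2|A2] := eqVneq #|A|.+1 #|T|.
    have : #|[set: T] :\: A| == 1%N by rewrite cardsD setTI cardsT -A2 subSnn.
    by case/cards1P=> v vE; exists v; apply: acts1; rewrite -vE actsD.
  have := card_acts_bin sGT (subsetT A) aA; rewrite cardsT => le1.
  have : ('C(#|T|, 2) <= 'C(#|T|, #|A|))%N by apply: leq_bin2; lia.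
  rewrite -(leq_pmul2l (cardG_gt0 G)) => le2.
  have := leq_trans le2 le1; rewrite -leq_double -muln2 -mulnA.
  have /= := bin_ffact #|T| 2; rewrite ffactnS ffactn1 (_ : 2`! = 2) // => ->.
  by rewrite -subn1 mulnC leqNgt idx.
have sGv : G \subset Sym ([set: T] :\ v).
  apply/subsetP=> g gG; apply/Sym_setP=> y; rewrite !inE andbT negbK => /eqP->.
  exact: fixv.
have cardTv : #|[set: T] :\ v| = #|T|.-1.
  by have := cardsD1 v [set: T]; rewrite inE cardsT => ->.
exists v; split=> // g gv even_g; apply: (small_index_even sGv) even_g.
  have n0 : (0 < #|T|)%N by rewrite -cardsT.
  rewrite cardTv -(ltn_pmul2l n0); move: idx.
  by case: #|T| n0 => // m _; rewrite factS doubleMr subn1 mulnA.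
by apply/Sym_setP=> y; rewrite !inE andbT negbK => /eqP->.
Qed.

Lemma even_perm_maps x y : (2 < #|T|)%N ->
  exists2 g : {perm T}, ~~ odd_perm g & g x = y.
Proof.
move=> T3; have [->|xy] := eqVneq x y.
  by exists 1; rewrite ?odd_perm1 ?perm1.
have : (0 < #|~: [set x; y]|)%N by rewrite cardsCs setCK cards2 xy; lia.
case/card_gt0P=> z; rewrite !inE negb_or => /andP[zx zy].
exists (cycle3 x y z); last by rewrite cycle3E1 // 1?eq_sym.
by rewrite odd_permM !odd_tperm xy eq_sym zx.
Qed.

Lemma even_perm_separates x y : (3 < #|T|)%N -> x != y ->
  exists g : {perm T}, [/\ ~~ odd_perm g, g x = x & g y != y].
Proof.
move=> T4 xy.
have : (1 < #|~: [set x; y]|)%N by rewrite cardsCs setCK cards2 xy; lia.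
case/card_gt1P=> a [b []]; rewrite !inE !negb_or.
move=> /andP[ax ay] /andP[bx by_] ab; exists (cycle3 y a b).
split; first by rewrite odd_permM !odd_tperm [y == a]eq_sym ay [y == b]eq_sym by_.
  by rewrite cycle3D // eq_sym.
by rewrite cycle3E1 // eq_sym.
Qed.

End PermutationGroups.

(** * Translation-stable families of sets of permutations *)

Section TranslateFamilies.
Local Open Scope group_scope.
Variable n : nat.
Hypothesis n6 : (5 < n)%N.
Implicit Types (Z : {set 'S_n}) (g h : 'S_n) (k i : 'I_n).

Definition prefix k : {set 'I_n} := [set i : 'I_n | (i < k)%N].

Definition pred_ord k : 'I_n := Ordinal (leq_ltn_trans (leq_pred k) (ltn_ord k)).

(** Pigeonhole on the at least three points outside S. Exchanging such a pair corrects the parity of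
    a permutation without changing how it treats A. *)
Lemma pair_outside (A S : {set 'I_n}) : (#|S| + 2 < n)%N ->
  exists a b, [/\ a != b, a \notin S, b \notin S & (a \in A) = (b \in A)].
Proof.
move=> S3; have : (1 < #|A :\: S|)%N || (1 < #|~: A :\: S|)%N.
  have := cardsC S; have := cardsID A (~: S); rewrite card_ord.
  rewrite setIC -setDE [~: S :\: A]setDE setIC -setDE; lia.
case/orP=> /card_gt1P[a [b []]]; rewrite !inE => /andP[aS aA] /andP[bS bA] ab.
  by exists a, b; rewrite aA bA.
by exists a, b; rewrite (negPf aA) (negPf bA).
Qed.

Lemma even_facet_neighbour k : (0 < k)%N -> exists z : 'S_n,
  [/\ ~~ odd_perm z, z (pred_ord k) = k, z k = pred_ord k &
      forall i, i != k -> i != pred_ord k -> (z i \in prefix k) = (i \in prefix k)].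
Proof.
move=> k0; set x := pred_ord k.
have xk : x != k by rewrite -val_eqE /=; lia.
have [|a [b [ab]]] := @pair_outside (prefix k) [set x; k].
  by rewrite cards2; case: (_ != _); lia.
rewrite !inE !negb_or => /andP[ax ak] /andP[bx bk] abk.
exists (tperm x k * tperm a b); split.
- by rewrite odd_permM !odd_tperm xk ab.
- by rewrite permM tpermL tpermD.
- by rewrite permM tpermR tpermD.
move=> i ik ix; rewrite permM (_ : tperm x k i = i); last by rewrite tpermD // eq_sym.
by case: tpermP => [->|->|//]; rewrite !inE abk.
Qed.

Lemma even_prefix_perm k i j : (i \in prefix k) = (j \in prefix k) ->
  exists g : 'S_n, [/\ ~~ odd_perm g, g i = j &
    forall l, (g l \in prefix k) = (l \in prefix k)].
Proof.
move=> ijk; have [|a [b [ab]]] := @pair_outside (prefix k) [set i; j].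
  by rewrite cards2; case: (_ != _); lia.
rewrite !inE !negb_or => /andP[ai aj] /andP[bi bj] abk.
have [<-|ij] := eqVneq i j.
  by exists 1; rewrite odd_perm1 perm1; split=> // l; rewrite perm1.
exists (tperm i j * tperm a b); split.
- by rewrite odd_permM !odd_tperm ij ab.
- by rewrite permM tpermL tpermD.
move=> l; rewrite permM; rewrite !inE in ijk.
have tp (u v w : 'I_n) : (u < k)%N = (v < k)%N ->
    (tperm u v w \in prefix k) = (w \in prefix k).
  by move=> uv; case: tpermP => [->|->|//]; rewrite !inE uv.
by rewrite !tp.
Qed.

Lemma imset_prefix k (g : 'S_n) :
    (forall l, (g l \in prefix k) = (l \in prefix k)) ->
  [set g l | l in prefix k] = prefix k.
Proof.
move=> gk; apply/eqP; rewrite eqEcard (card_imset _ (@perm_inj _ g)) leqnn andbT.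
by apply/subsetP=> _ /imsetP[l lk ->]; rewrite gk.
Qed.

(** * Stabilizers under right translation *)

Notation stab Z := ('C[Z | 'Rs])%g.

Lemma stabP Z g : reflect (Z :* g = Z) (g \in stab Z).
Proof. by apply: (iffP astab1P); rewrite /= rcosetE. Qed.

Lemma stab_mem Z g h : g \in stab Z -> (h * g \in Z) = (h \in Z).
Proof. by move/stabP=> {1}<-; rewrite mem_rcoset mulgK. Qed.

Lemma card_translates Z (S : {set {set 'S_n}}) :
    (forall g, Z :* g \in S) ->
  exists2 N, (N <= #|S|)%N & n`! = (N * #|stab Z|)%N.
Proof.
move=> trS; exists #|orbit 'Rs [set: 'S_n] Z|.
  by apply/subset_leq_card/subsetP=> _ /orbitP[g _ <-]; rewrite /= rcosetE.
have := card_orbit_stab 'Rs [set: 'S_n]%G Z; rewrite setTI => ->.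
by rewrite cardsT card_Sn.
Qed.

(* A pair [(k, w)] is recovered from an even translate of [Z k] taking the
   centre [v k] to [w]: the stabilizer of the translate determines [w], and then
   the separating position determines [k]. *)
Lemma card_centred_translates (K : {set 'I_n}) (Z : 'I_n -> {set 'S_n})
    (v : 'I_n -> 'I_n) (S : {set {set 'S_n}}) :
    (forall k g, k \in K -> Z k :* g \in S) ->
    (forall k g, k \in K -> g \in stab (Z k) -> g (v k) = v k) ->
    (forall k g, k \in K -> ~~ odd_perm g -> g (v k) = v k -> g \in stab (Z k)) ->
    (forall k l, k \in K -> l \in K -> (k < l)%N -> exists i b, forall g,
       ~~ odd_perm g -> (g i = v k -> (g \in Z k) = b) /\
                        (g i = v l -> (g \in Z l) = ~~ b)) ->
  (#|K| * n <= #|S|)%N.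
Proof.
move=> ZS fixv evenv sep.
have n_gt (m : nat) : (m < 6)%N -> (m < #|'I_n|)%N.
  by rewrite card_ord => m6; apply: leq_trans m6 n6.
have mapsP (p : 'I_n * 'I_n) : exists g : 'S_n, ~~ odd_perm g && (g (v p.1) == p.2).
  by have [|g ge /eqP gv] := @even_perm_maps _ (v p.1) p.2; [apply: n_gt | exists g; rewrite ge].
have [g gP] := fin_all_exists mapsP.
have ge p : ~~ odd_perm (g p) by case/andP: (gP p).
have gv p : g p (v p.1) = p.2 by case/andP: (gP p) => _ /eqP.
pose f p := Z p.1 :* g p.
have inX p : (p \in setX K [set: 'I_n]) = (p.1 \in K).
  by case: p => k w; rewrite in_setX in_setT andbT.
have fI : {in setX K [set: 'I_n] &, injective f}.
  move=> p q; rewrite !inX => pK qK fpq.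
  have stabf r s : s \in stab (f r) -> s ^ (g r)^-1 \in stab (Z r.1).
    move/stabP=> fs; apply/stabP; rewrite /conjg invgK.
    by rewrite !rcosetM -/(f r) fs rcosetK.
  have fstab r s : r.1 \in K -> ~~ odd_perm s -> s r.2 = r.2 -> s \in stab (f r).
    move=> rK se sr; apply/stabP; rewrite /f -rcosetM.
    have -> : g r * s = (g r * s * (g r)^-1) * g r by rewrite mulgKV.
    rewrite rcosetM; congr (_ :* _); apply/stabP/evenv => //.
      by rewrite !odd_permM odd_permV addbAC addbb.
    by rewrite !permM gv sr -gv permK.
  have pq2 : p.2 = q.2.
    apply/eqP/negPn/negP => /(even_perm_separates (n_gt 3 isT))[s [se sp]].
    case/negP; have := fstab p s pK se sp; rewrite fpq => /stabf.
    move/(fixv _ _ qK); rewrite /conjg invgK !permM gv => sq.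
    by rewrite -{2}gv -sq permKV.
  have rec r s : (s \in f r) = (s * (g r)^-1 \in Z r.1) by rewrite mem_rcoset.
  (* An even s taking the separating position i to the common second component lies in the translate
     [f r] exactly if b holds, and in [f t] exactly if b fails. *)
  have npq r t : r.1 \in K -> t.1 \in K -> r.2 = t.2 -> f r = f t ->
      ~~ (r.1 < t.1)%N.
    move=> rK tK rt2 frt; apply/negP => /(sep _ _ rK tK)[i [b sb]].
    have [|s se si] := @even_perm_maps _ i r.2; first exact: n_gt.
    have ev u : ~~ odd_perm (s * (g u)^-1).
      by rewrite odd_permM odd_permV (negPf se) (negPf (ge u)).
    have val u : s i = u.2 -> (s * (g u)^-1) i = v u.1.
      by move=> su; rewrite permM su -gv permK.
    have [/(_ (val r si)) e1 _] := sb _ (ev r).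
    have [_ /(_ (val t (etrans si rt2))) e2] := sb _ (ev t).
    by move: e2; rewrite -rec -frt rec e1; case: (b).
  have pq1 : p.1 = q.1.
    by apply/val_inj/eqP; rewrite eqn_leq leqNgt npq // leqNgt npq.
  by rewrite [p]surjective_pairing [q]surjective_pairing pq1 pq2.
have <- : #|setX K [set: 'I_n]| = (#|K| * n)%N by rewrite cardsX cardsT card_ord.
rewrite -(card_in_imset fI); apply/subset_leq_card/subsetP=> _ /imsetP[p pK ->].
by apply: ZS; rewrite -inX.
Qed.

Lemma imset_facet_neighbour k (z : 'S_n) : (0 < k)%N ->
    z (pred_ord k) = k -> z k = pred_ord k ->
    (forall i, i != k -> i != pred_ord k -> (z i \in prefix k) = (i \in prefix k)) ->
  [set z i | i in prefix k] = k |: (prefix k :\ pred_ord k).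
Proof.
set x := pred_ord k => k0 zx zk zi.
have xk : x \in prefix k by rewrite inE /=; lia.
have kk : k \notin prefix k by rewrite inE ltnn.
apply/eqP; rewrite eqEcard (card_imset _ (@perm_inj _ z)); apply/andP; split.
  apply/subsetP=> _ /imsetP[i ik ->]; rewrite !in_setU1 in_setD1.
  have [->|ix] := eqVneq i x; first by rewrite zx eqxx.
  have ik' : i != k by apply: contraNneq kk => {1}<-.
  have zix : z i != x by rewrite -zk (inj_eq perm_inj).
  by rewrite zi // ik zix orbT.
by rewrite cardsU1 !inE ltnn andbF (cardsD1 x (prefix k)) xk.
Qed.

(** If h and z sent the prefix to the same set, z followed by the inverse of h would preserve the
    prefix, hence lie in Z; translating back by h would put z into Z. *)
Lemma stab_no_neighbour k Z (z h : 'S_n) :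
    (forall g : 'S_n, [set g i | i in prefix k] = prefix k -> g \in Z) ->
    z \notin Z -> h \in stab Z ->
  [set h i | i in prefix k] != [set z i | i in prefix k].
Proof.
move=> FZ zZ hZ; apply: contraNneq zZ => hz.
rewrite -(mulgKV h z) stab_mem //; apply: FZ.
have -> : [set (z * h^-1) i | i in prefix k]
        = [set h^-1 i | i in [set z i | i in prefix k]].
  by rewrite -imset_comp; apply: eq_imset => i; rewrite permM.
rewrite -hz -imset_comp -[RHS]imset_id; apply: eq_imset => i.
by rewrite /= permK.
Qed.

(** * Contradiction from a small separating family *)

Section SmallFamily.
Variable ZZ : {set {set 'S_n}}.
Hypothesis ZZ_translate : forall Z g, Z \in ZZ -> Z :* g \in ZZ.
Hypothesis ZZ_separates : forall k (z : 'S_n), (0 < k)%N ->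
  [set z i | i in prefix k] != prefix k ->
  exists2 Z, Z \in ZZ &
    (forall g : 'S_n, [set g i | i in prefix k] = prefix k -> g \in Z) /\ z \notin Z.

Definition facet_witness k (Z : {set 'S_n}) (z : 'S_n) :=
  [/\ Z \in ZZ, (forall g : 'S_n, [set g i | i in prefix k] = prefix k -> g \in Z),
      z \notin Z & [/\ ~~ odd_perm z, z (pred_ord k) = k, z k = pred_ord k &
      forall i, i != k -> i != pred_ord k -> (z i \in prefix k) = (i \in prefix k)]].

Lemma facet_witness_exists k : (0 < k)%N -> exists Z z, facet_witness k Z z.
Proof.
move=> k0; have [z zP] := even_facet_neighbour k0.
have [ze zx zk zi] := zP.
have [|Z ZZZ [FZ zZ]] := @ZZ_separates k z k0; last by exists Z, z.
apply/eqP=> zF; have : z (pred_ord k) \in prefix k.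
  by rewrite -zF imset_f // inE /=; lia.
by rewrite zx inE ltnn.
Qed.

Notation transitive_stab Z := [transitive stab Z, on [set: 'I_n] | 'P].

(** The stabilizer of a translate by g is the conjugate by g of the stabilizer. *)
Lemma transitive_stabJ Z g : transitive_stab (Z :* g) -> transitive_stab Z.
Proof.
move=> trg; apply: transitive_SymI.
- by apply/set0Pn; exists (Ordinal (ltn_trans (ltn0Sn 4) n6)).
- move=> x y _ _; have [||h hS hx] := trans_witness (x := g x) (y := g y) trg.
  + by rewrite inE.
  + by rewrite inE.
  exists (g * h * g^-1); last by rewrite !permM hx permK.
  apply/stabP; move/stabP: hS; rewrite -!rcosetM => hS.
  by rewrite rcosetM hS rcosetK.
- by apply/subsetP=> h _; apply/Sym_setP=> x; rewrite inE.
Qed.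

Lemma transitive_stab_translate Z g :
  transitive_stab (Z :* g) = transitive_stab Z.
Proof.
apply/idP/idP; first exact: transitive_stabJ.
by rewrite -{1}[Z](rcosetK g); apply: transitive_stabJ.
Qed.

Lemma facet_witness_even_stab k Z z : facet_witness k Z z ->
  ~ (forall g, g \in Sym [set: 'I_n] -> ~~ odd_perm g -> g \in stab Z).
Proof.
case=> _ FZ zZ [ze _ _ _] ev.
have zT : z \in Sym [set: 'I_n] by apply/Sym_setP=> x; rewrite inE.
by have := stab_no_neighbour FZ zZ (ev z zT ze); rewrite eqxx.
Qed.

(** The prefix is a single point, so a transitive stabilizer contains an element that moves it
    exactly as z does. *)
Lemma facet_witness_prefix1 k Z z : facet_witness k Z z -> k = 1%N :> nat ->
  ~~ transitive_stab Z.
Proof.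
case=> _ FZ zZ [ze zx zk zi] k1; apply/negP=> trZ.
have [||h hZ hx] := trans_witness (x := pred_ord k) (y := k) trZ; rewrite ?inE //.
have := stab_no_neighbour FZ zZ hZ.
have -> : prefix k = [set pred_ord k].
  by apply/setP=> i; rewrite !inE -val_eqE /= k1; lia.
by rewrite !imset_set1 hx zx eqxx.
Qed.

(** The same argument applied to the complement of the prefix, here a single point. *)
Lemma facet_witness_prefix_max k Z z : facet_witness k Z z -> k = n.-1 :> nat ->
  ~~ transitive_stab Z.
Proof.
case=> _ FZ zZ [ze zx zk zi] k1; apply/negP=> trZ.
have [||h hZ hx] := trans_witness (x := k) (y := pred_ord k) trZ; rewrite ?inE //.
have := stab_no_neighbour FZ zZ hZ.
have -> : prefix k = ~: [set k].
  apply/setP=> i; rewrite !inE -val_eqE /=; have := ltn_ord i; lia.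
have imC (g : 'S_n) : [set g i | i in ~: [set k]] = ~: [set g k].
  apply/setP=> i; rewrite in_setC in_set1; apply/imsetP/idP=> [[j jk ->]|ik].
    by rewrite (inj_eq perm_inj) -in_set1 -in_setC.
  exists (g^-1 i); last by rewrite permKV.
  by rewrite in_setC in_set1; apply: contraNneq ik => <-; rewrite permKV.
by rewrite !imC hx zk eqxx.
Qed.

Hypothesis small : (#|ZZ|.*2 < n * (n - 1))%N.

Lemma small_centre Z : Z \in ZZ -> ~~ transitive_stab Z ->
  exists v, (forall g, g \in stab Z -> g v = v) /\
            (forall g, g v = v -> ~~ odd_perm g -> g \in stab Z).
Proof.
move=> ZZZ; apply: intransitive_fixed_point; rewrite card_ord.
have [N leN ->] := card_translates (fun g => ZZ_translate g ZZZ).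
by rewrite doubleMl ltn_pmul2r ?cardG_gt0 // (leq_ltn_trans _ small) // leq_double.
Qed.

Definition intransitive_part := [set Z in ZZ | ~~ transitive_stab Z].

Lemma intransitive_translate Z g :
  Z \in intransitive_part -> Z :* g \in intransitive_part.
Proof.
rewrite !inE => /andP[ZZZ ntr].
by rewrite ZZ_translate // transitive_stab_translate.
Qed.

Lemma transitive_translates_card Z : Z \in ZZ -> transitive_stab Z ->
  exists2 N, (N + #|intransitive_part| <= #|ZZ|)%N & n`! = (N * #|stab Z|)%N.
Proof.
move=> ZZZ trZ.
have [g|N leN nE] := @card_translates Z (ZZ :\: intransitive_part).
  by rewrite !inE ZZ_translate // transitive_stab_translate trZ.
exists N => //; move: leN; rewrite -(cardsID intransitive_part ZZ).
have /setIidPr-> : intransitive_part \subset ZZ.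
  by apply/subsetP=> Y; rewrite inE => /andP[].
by rewrite addnC; lia.
Qed.

(* If the centre v of [Z k] lies in the prefix, then membership of an even g in
   [Z k] depends only on the position of v, and k is the first position
   avoiding [Z k]; otherwise k - 1 is the last such position. *)
Lemma intransitive_count (K : {set 'I_n}) (Z : 'I_n -> {set 'S_n}) (z : 'I_n -> 'S_n) :
    (forall k, k \in K -> (0 < k)%N /\ facet_witness k (Z k) (z k)) ->
    (forall k, k \in K -> Z k \in intransitive_part) ->
  exists K1 : {set 'I_n}, [/\ K1 \subset K, (#|K1| * n <= #|intransitive_part|)%N
               & (#|K :\: K1| * n <= #|intransitive_part|)%N].
Proof.
move=> KP KI.
have vP k : exists v, k \in K -> (forall g, g \in stab (Z k) -> g v = v) /\
            (forall g, g v = v -> ~~ odd_perm g -> g \in stab (Z k)).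
  have [kK|] := boolP (k \in K); last by exists k.
  have := KI k kK; rewrite inE => /andP[ZZZ ntr].
  by have [v vZ] := small_centre ZZZ ntr; exists v.
have [v {}vP] := fin_all_exists vP.
have fixv k g : k \in K -> g \in stab (Z k) -> g (v k) = v k.
  by move=> kK; apply: (vP k kK).1.
have evv k g : k \in K -> ~~ odd_perm g -> g (v k) = v k -> g \in stab (Z k).
  by move=> kK ge gv; apply: (vP k kK).2.
have same k g h i : k \in K -> ~~ odd_perm g -> ~~ odd_perm h ->
    g i = v k -> h i = v k -> (g \in Z k) = (h \in Z k).
  move=> kK ge he gi hi; rewrite -[h](mulKVg g) stab_mem //.
  apply: evv => //; first by rewrite odd_permM odd_permV (negPf ge) (negPf he).
  by rewrite permM -{1}gi permK hi.
have inZ k g i : k \in K -> ~~ odd_perm g -> g i = v k ->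
    (i \in prefix k) = (v k \in prefix k) -> g \in Z k.
  move=> kK ge gi ik; have [h [he hi hk]] := even_prefix_perm ik.
  rewrite (same k g h i) //; have [_ [_ FZ _ _]] := KP k kK.
  exact/FZ/imset_prefix.
have outZ k g i : k \in K -> ~~ odd_perm g -> g i = v k -> z k i = v k ->
    g \in Z k = false.
  move=> kK ge gi zi; have [_ [_ _ zZ [ze _ _ _]]] := KP k kK.
  by rewrite (same k g (z k) i) // (negPf zZ).
(* The position that [z k] sends to the centre lies on the other side of the prefix from the centre,
   since otherwise [inZ] puts [z k] into [Z k]. Only k and its predecessor change sides under
   [z k]. *)
have zv k : k \in K -> z k (if v k \in prefix k then k else pred_ord k) = v k.
  move=> kK; have [k0 [_ FZ zZ [ze zx zk zi]]] := KP k kK.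
  set j := (z k)^-1 (v k); have zj : z k j = v k by rewrite permKV.
  have jv : (j \in prefix k) != (v k \in prefix k).
    by apply: contraNneq zZ; apply: inZ.
  have [jk|jk] := eqVneq j k.
    move: jv; rewrite -zj jk zk; rewrite !inE ltnn /=.
    by have -> : (k.-1 < k)%N by lia.
  have [jx|jx] := eqVneq j (pred_ord k).
    by rewrite -zj jx zx inE ltnn zx.
  by rewrite -zi // zj eqxx in jv.
exists [set k in K | v k \in prefix k]; split.
- by apply/subsetP=> k; rewrite inE => /andP[].
- apply: (@card_centred_translates _ Z v); try by move=> k; rewrite inE => g /andP[].
  + by move=> k g; rewrite inE => /andP[/KI kI _]; apply: intransitive_translate.
  + by move=> k g; rewrite inE => /andP[kK _]; apply: fixv.
  + by move=> k g; rewrite inE => /andP[kK _]; apply: evv.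
  move=> k l; rewrite !in_set => /andP[kK kv] /andP[lK lv] kl.
  (* Position k lies outside [prefix k] but inside [prefix l]. *)
  exists k, false => g ge; split=> gk.
    by apply: (outZ k g k) => //; have := zv k kK; rewrite in_set kv.
  by apply: (inZ l g k) => //; rewrite !in_set kl.
- apply: (@card_centred_translates _ Z v).
  + by move=> k g; rewrite inE => /andP[_ /KI kI]; apply: intransitive_translate.
  + by move=> k g; rewrite inE => /andP[_ kK]; apply: fixv.
  + by move=> k g; rewrite inE => /andP[_ kK]; apply: evv.
  move=> k l; rewrite !in_set => /andP[kv kK] /andP[lv lK] kl.
  rewrite kK /= in kv; rewrite lK /= in lv.
  (* As k < l, the position l - 1 is still at least k, hence outside [prefix k], while it is the
     last one inside [prefix l]. *)
  exists (pred_ord l), true => g ge; split=> gk.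
    apply: (inZ k g (pred_ord l)) => //; rewrite !in_set (negPf kv) /=.
    by apply/negbTE; lia.
  by apply: (outZ l g (pred_ord l)) => //; have := zv l lK; rewrite in_set (negPf lv).
Qed.

Lemma small_family_absurd : False.
Proof.
have wP k : exists p : {set 'S_n} * 'S_n, (0 < k)%N -> facet_witness k p.1 p.2.
  have [k0|k0] := posnP k; first by exists (set0, 1).
  by have [Z [z zP]] := facet_witness_exists k0; exists (Z, z).
have [w {}wP] := fin_all_exists wP.
pose K := [set k : 'I_n | (0 < k)%N && ((w k).1 \in intransitive_part)].
have [|k|K1 [sK1 c1 c2]] := @intransitive_count K (fun k => (w k).1) (fun k => (w k).2).
- by move=> k; rewrite inE => /andP[k0 _]; split=> //; apply: wP.
- by rewrite inE => /andP[].
have cK : #|K| = (#|K1| + #|K :\: K1|)%N.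
  by rewrite -(cardsID K1 K) (setIidPr sK1).
have memK k : (0 < k)%N -> k \notin K -> transitive_stab (w k).1.
  move=> k0; rewrite !inE k0 /= negb_and negbK.
  by have [-> _ _ _] := wP k k0.
have n_gt (m : nat) : (m < 6)%N -> (m < n)%N by move=> m6; apply: leq_trans m6 n6.
pose o1 := Ordinal (n_gt 1%N isT); pose o2 := Ordinal (n_gt 2%N isT).
have nm_lt : (n.-1 < n)%N by move: n6; case: (n).
pose om := Ordinal nm_lt.
have k1K : o1 \in K.
  apply/negPn/negP => /(memK o1 isT); apply/negP.
  exact: facet_witness_prefix1 (wP o1 isT) _.
have kmK : om \in K.
  have m0 : (0 < om)%N by rewrite /=; lia.
  apply/negPn/negP => /(memK om m0); apply/negP.
  exact: facet_witness_prefix_max (wP om m0) _.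
have leI : (n <= #|intransitive_part|)%N.
  have : (0 < #|K|)%N by apply/card_gt0P; exists o1.
  by rewrite cK; move: c1 c2; case: #|K1|; case: #|K :\: K1|; nia.
have leIZ : (#|intransitive_part| <= #|ZZ|)%N.
  by apply/subset_leq_card/subsetP=> Y; rewrite inE => /andP[].
have sGT (G : {group 'S_n}) : G \subset Sym [set: 'I_n].
  by apply/subsetP=> h _; apply/Sym_setP=> x; rewrite inE.
(* If all n - 1 positive k belong to K, the two counts add up to n (n - 1) <= 2 |ZZ|. Otherwise some
   witness has a transitive stabilizer. *)
have [sub|/subsetPn[k0]] := boolP ([set k : 'I_n | (0 < k)%N] \subset K).
  have := subset_leq_card sub.
  have -> : #|[set k : 'I_n | (0 < k)%N]| = n.-1.
    have -> : [set k : 'I_n | (0 < k)%N] = ~: [set Ordinal (n_gt 0%N isT)].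
      by apply/setP=> i; rewrite !inE -val_eqE /= lt0n.
    by rewrite cardsCs setCK cards1 card_ord subn1.
  rewrite cK => leK; have := leq_mul leK (leqnn n).
  rewrite mulnDl [X in (X <= _)%N]mulnC -subn1 => le1.
  have := leq_trans le1 (leq_trans (leq_add c1 c2) (leq_add leIZ leIZ)).
  by rewrite addnn leqNgt small.
rewrite inE => k0_gt0 /(memK _ k0_gt0) tr0.
have [ZZ0 _ _ _] := wP k0 k0_gt0.
have nev0 := facet_witness_even_stab (wP k0 k0_gt0).
have [N leN nN] := transitive_translates_card ZZ0 tr0.
have cT : #|[set: 'I_n]| = n by rewrite cardsT card_ord.
have [n7|n_le6] := ltnP 6 n.
  (* At least n (n - 3) / 2 transitive members and n intransitive ones make n (n - 1) / 2. *)
  have := transitive_index_bound (sGT _) tr0; rewrite cT => /(_ n7 nev0).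
  rewrite nN doubleMl mulnC leq_pmul2r ?cardG_gt0 //.
  by move: small; nia.
have nE : n = 6 by apply/eqP; rewrite eqn_leq n_le6.
have factE : n`! = 6`! by rewrite nE.
have nn : (n * (n - 1) = 30)%N by rewrite nE.
have c1' : (#|K1| * 6 <= #|intransitive_part|)%N by rewrite -nE.
have c2' : (#|K :\: K1| * 6 <= #|intransitive_part|)%N by rewrite -nE.
have leI' : (6 <= #|intransitive_part|)%N by rewrite -{1}nE.
have ge6 Z : ~ (forall g, g \in Sym [set: 'I_n] -> ~~ odd_perm g -> g \in stab Z) ->
    transitive_stab Z -> (#|stab Z| * 6 <= n`!)%N.
  by move=> nev tr; rewrite factE; apply: transitive6_index_ge6 (sGT _) tr _ nev; rewrite cT.
have N6 : (6 <= N)%N.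
  by have := ge6 _ nev0 tr0; rewrite nN mulnC leq_pmul2r ?cardG_gt0.
have ZZ14 : (#|ZZ| <= 14)%N by move: small; rewrite nn; lia.
(* At least 6 of at most 14 members are transitive, so at most 8 are intransitive and each part of K
   has at most one element; 1 and 5 are already in K. *)
have o2K : o2 \notin K.
  apply/negP=> o2K; have : (2 < #|K|)%N.
    by apply/card_gt2P; exists o1, o2, om; split; split; rewrite // -val_eqE /= nE.
  by rewrite cK; move: leN N6 ZZ14 c1' c2'; clear; lia.
have tr2 := memK o2 isT o2K; have w2 := wP o2 isT.
have [ZZ2 FZ zZ [_ zx zk zi]] := w2.
have [N2 leN2 nN2] := transitive_translates_card ZZ2 tr2.
(* The 6 or more intransitive members leave at most 8 translates, so the stabilizer is 2-transitive.
   It thus has an element fixing 0 and taking 1 to 2, which sends the prefix {0, 1} where z sends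
   it. *)
have idx2 : (6`! < #|stab (w o2).1| * 9)%N.
  rewrite -factE nN2 mulnC ltn_pmul2l ?cardG_gt0 //.
  by move: leN2 leI' ZZ14; clear; lia.
pose o0 := pred_ord (pred_ord o2).
have := transitive6_2trans (sGT _) tr2 _ (facet_witness_even_stab w2) idx2 (in_setT o0).
rewrite cT => /(_ nE) tr3.
have [||h /setIP[hZ /astab1P h0] h1] := trans_witness (x := pred_ord o2) (y := o2) tr3.
- by rewrite !inE -val_eqE.
- by rewrite !inE -val_eqE.
have := stab_no_neighbour FZ zZ hZ.
rewrite (imset_facet_neighbour _ zx zk zi) //.
have pE : prefix o2 = [set pred_ord o2; o0].
  by apply/setP=> i; rewrite !inE -!val_eqE /=; case: (nat_of_ord i) => [|[|m]].
rewrite pE imsetU1 imset_set1 h1; rewrite /= /aperm in h0; rewrite h0.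
rewrite setU1K ?eqxx // !inE -val_eqE //.
Qed.

End SmallFamily.

Lemma separating_family_bound (ZZ : {set {set 'S_n}}) :
    (forall Z g, Z \in ZZ -> Z :* g \in ZZ) ->
    (forall k (z : 'S_n), (0 < k)%N -> [set z i | i in prefix k] != prefix k ->
       exists2 Z, Z \in ZZ &
         (forall g : 'S_n, [set g i | i in prefix k] = prefix k -> g \in Z) /\
         z \notin Z) ->
  (n * (n - 1) <= #|ZZ|.*2)%N.
Proof.
by move=> tr sep; rewrite leqNgt; apply/negP; apply: small_family_absurd.
Qed.

End TranslateFamilies.

(** * Zero sets of the section and the facet inequalities *)

Section SlackSeparation.
Local Open Scope ring_scope.
Variables (R : realType) (n : nat).
Implicit Types (k : 'I_n) (z g : 'S_n).

(** This turns the symmetry of the section into right translation of zero sets. *)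
Lemma perm_act_vertex z g :
  perm_act g (perm_vertex R z) = perm_vertex R (z * g)%g.
Proof. by apply/rowP=> v; rewrite !mxE invMg permM. Qed.

(** Elements of A outside the prefix are at least k; they replace equally many prefix elements, each
    at most k - 1. *)
Lemma prefix_sum_le k (A : {set 'I_n}) : #|A| = #|prefix k| ->
  (\sum_(i in prefix k) i + #|A :\: prefix k| <= \sum_(i in A) i)%N.
Proof.
move=> cA; have cD : #|A :\: prefix k| = #|prefix k :\: A|.
  by move: cA; rewrite -(cardsID (prefix k) A) -(cardsID A (prefix k)) setIC; lia.
rewrite (big_setID A) [leqRHS](big_setID (prefix k)) /= setIC -addnA leq_add2l.
apply: (@leq_trans (#|A :\: prefix k| * k)).
  rewrite cD -sum_nat_const -sum1_card -big_split /=; apply: leq_sum => i.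
  by rewrite !inE addn1 => /andP[].
rewrite -sum_nat_const; apply: leq_sum => i; rewrite !inE => /andP[+ _].
by rewrite -leqNgt.
Qed.

Definition prefix_form k (x : 'rV[R]_n) : R := \sum_(v in prefix k) x 0 v.

Lemma prefix_form_vertex k z : prefix_form k (perm_vertex R z) =
  (\sum_(i in [set (z^-1)%g v | v in prefix k]) i + #|prefix k|)%:R.
Proof.
rewrite big_imset /=; last by move=> ? ? _ _; apply: perm_inj.
rewrite natrD natr_sum -sum1_card natr_sum -big_split /=; apply: eq_bigr => v _.
by rewrite mxE -natr1.
Qed.

Lemma imset_permV k z : [set z v | v in prefix k] = prefix k ->
  [set (z^-1)%g v | v in prefix k] = prefix k.
Proof.
move=> zk; rewrite -{1}zk -imset_comp -[RHS]imset_id.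
by apply: eq_imset => v; rewrite /= permK.
Qed.

(** The right-hand side 1 + ... + k of the facet inequality; the cardinality accounts for indices
    starting at 0. *)
Definition prefix_value k : R := (\sum_(i in prefix k) i + #|prefix k|)%:R.

Lemma prefix_form_facet k z : [set z v | v in prefix k] = prefix k ->
  prefix_form k (perm_vertex R z) = prefix_value k.
Proof. by move=> zk; rewrite prefix_form_vertex imset_permV. Qed.

Lemma prefix_form_ge k z : prefix_value k <= prefix_form k (perm_vertex R z).
Proof.
rewrite prefix_form_vertex ler_nat leq_add2r.
by apply: leq_trans (prefix_sum_le _); [apply: leq_addr | apply/card_imset/perm_inj].
Qed.

Lemma prefix_form_gt k z : [set z v | v in prefix k] != prefix k ->
  prefix_value k < prefix_form k (perm_vertex R z).
Proof.
move=> zk; rewrite prefix_form_vertex ltr_nat ltn_add2r.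
set A := imset _ _; have cA : #|A| = #|prefix k| by apply/card_imset/perm_inj.
apply: leq_trans (prefix_sum_le cA); rewrite -addn1 leq_add2l card_gt0 setD_eq0.
apply: contra zk => sA; have AE : A = prefix k by apply/eqP; rewrite eqEcard sA cA /=.
rewrite -[z]invgK; apply/eqP/imset_permV; exact: AE.
Qed.

Lemma prefix_form_lin k a b (x y : 'rV[R]_n) :
  prefix_form k (a *: x - b *: y) = a * prefix_form k x - b * prefix_form k y.
Proof.
by rewrite /prefix_form !big_distrr -sumrB; apply: eq_bigr => v _; rewrite !mxE.
Qed.

Lemma prefix_form_sum k (I : finType) (P : pred I) (x : I -> 'rV[R]_n) :
  prefix_form k (\sum_(i | P i) x i) = \sum_(i | P i) prefix_form k (x i).
Proof.
by rewrite /prefix_form exchange_big; apply: eq_bigr => v _; rewrite summxE.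
Qed.

Lemma prefix_form_permutahedron k (x : 'rV[R]_n) :
  permutahedron x -> prefix_value k <= prefix_form k x.
Proof.
case=> lam [lam0 [lam1 ->]]; rewrite prefix_form_sum.
rewrite -[prefix_value k]mul1r -lam1 big_distrl /=; apply: ler_sum => z _.
have -> : prefix_form k (lam z *: perm_vertex R z)
        = lam z * prefix_form k (perm_vertex R z).
  by rewrite /prefix_form big_distrr; apply: eq_bigr => v _; rewrite mxE.
by rewrite ler_wpM2l // prefix_form_ge.
Qed.

(* Otherwise the barycentre of the facet could be moved slightly away from the
   section value at z inside Q, and its projection would violate the facet
   inequality. *)
Lemma facet_separation (d m : nat) (A : 'M[R]_(d, m)) (b : 'rV[R]_m)
    (P : 'M[R]_(d, n)) (u : 'S_n -> 'rV[R]_d) k z :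
    subspace_extension A b P ->
    (forall g, subspace_polyhedron A b (u g) /\ u g *m P = perm_vertex R g) ->
    [set z v | v in prefix k] != prefix k ->
  exists2 j, forall g, [set g v | v in prefix k] = prefix k -> u g 0 j = 0
             & u z 0 j != 0.
Proof.
move=> [_ extP] uP zk; pose F := [set g : 'S_n | [set g v | v in prefix k] == prefix k].
have u0 g j : 0 <= u g 0 j by have [[_ ]] := uP g.
have [j /andP[/forallP/= Fj zj]|no_sep] := pickP (fun j : 'I_d =>
    [forall g, (g \in F) ==> (u g 0 j == 0)] && (u z 0 j != 0)).
  exists j => // g gk; apply/eqP; apply: (implyP (Fj g)).
  by rewrite inE gk.
exfalso; pose Y := \sum_(g in F) u g.
have YE j : Y 0 j = \sum_(g in F) u g 0 j by rewrite summxE.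
have Y0 j : 0 <= Y 0 j by rewrite YE sumr_ge0.
(* The j-th term alone gives [uC] where [Y 0 j] is positive. Where it vanishes, the failure of
   separation makes [u z 0 j] vanish too. *)
pose C := \sum_j u z 0 j / Y 0 j.
have C0 : 0 <= C by rewrite sumr_ge0 // => j _; rewrite divr_ge0.
have uC j : u z 0 j <= C * Y 0 j.
  have [Yj|Yj] := eqVneq (Y 0 j) 0.
    rewrite Yj mulr0; have := no_sep j; rewrite /= andbC.
    case: eqVneq => [->//|_] /= /negP[]; apply/forallP=> g; apply/implyP=> gF.
    by move/eqP: Yj; rewrite YE psumr_eq0 // => /allP/(_ g); rewrite mem_index_enum gF; apply.
  have Yj0 : 0 < Y 0 j by rewrite lt_def Yj Y0.
  rewrite -ler_pdivrMr // /C (bigD1 j) //= lerDl sumr_ge0 // => i _.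
  by rewrite divr_ge0.
pose N : R := #|F|%:R.
have N0 : 0 < N.
  rewrite ltr0n; apply/card_gt0P; exists 1%g; rewrite inE -[X in _ == X]imset_id.
  by apply/eqP/eq_imset => v; rewrite perm1.
(* The choice of a makes [a * N - e] equal to 1, so the combination y below stays in the affine
   subspace; the choice of e gives [e * C <= a], so y is nonnegative. *)
pose e := (1 + N * C)^-1; pose a := (1 + e) / N.
have NC0 : 0 < 1 + N * C by rewrite ltr_wpDr // mulr_ge0 // ltW.
have e0 : 0 < e by rewrite invr_gt0.
have aN : a * N = 1 + e by rewrite divfK // gt_eqF.
have eC : e * C <= a.
  have e1 : e * (1 + N * C) = 1 by rewrite mulVf // gt_eqF.
  by rewrite ler_pdivlMr //; lra.
pose y := a *: Y - e *: u z.
have Qy : subspace_polyhedron A b y.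
  split=> [|j]; last first.
    rewrite !mxE subr_ge0 (le_trans (ler_wpM2l (ltW e0) (uC j))) // mulrA.
    by rewrite ler_wpM2r.
  rewrite mulmxBl -!scalemxAl mulmx_suml.
  rewrite (eq_bigr (fun=> b)) => [|g _]; last by have [[]] := uP g.
  have [[-> _] _] := uP z.
  by rewrite sumr_const -scaler_nat scalerA aN -scalerBl addrK scale1r.
have /(prefix_form_permutahedron k) : permutahedron (y *m P) by apply/extP; exists y.
rewrite mulmxBl -!scalemxAl mulmx_suml prefix_form_lin prefix_form_sum.
rewrite (eq_bigr (fun=> prefix_value k)) => [|g]; last first.
  by rewrite inE => /eqP gk; have [_ ->] := uP g; apply: prefix_form_facet.
have [_ ->] := uP z; rewrite sumr_const -[_ *+ #|F|]mulr_natr -/N.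
(* The form at the projection of y is [prefix_value k] minus this positive quantity. *)
have : 0 < e * (prefix_form k (perm_vertex R z) - prefix_value k).
  by rewrite mulr_gt0 // subr_gt0 prefix_form_gt.
rewrite [a * _]mulrCA aN; lra.
Qed.

End SlackSeparation.

(** * The bound on the number of variables *)

Theorem theorem3 (R : realType) (n : nat) : (6 <= n)%N ->
  forall (d k : nat) (A : 'M[R]_(d, k)) (b : 'rV[R]_k) (P : 'M[R]_(d, n)),
    subspace_extension A b P -> weakly_symmetric A b P ->
    (n * (n - 1) %/ 2 <= d)%N.
Proof.
move=> n6 d k A b P extP [s [sP symP]].
pose u (g : 'S_n) := s (perm_vertex R g).
have vP (g : 'S_n) : perm_vertices (perm_vertex R g) by exists g.
have uP g : subspace_polyhedron A b (u g) /\ (u g *m P)%R = perm_vertex R g.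
  exact: sP.
pose zeros (j : 'I_d) := [set g : 'S_n | u g ord0 j == 0%R].
pose ZZ := [set zeros j | j : 'I_d].
have leZZ : #|ZZ| <= d by rewrite -[X in _ <= X]card_ord leq_imset_card.
apply: leq_trans leZZ; rewrite divn2 -[X in _ <= X]doubleK half_leq //.
apply: separating_family_bound => //.
(* Translating [zeros j] by g means evaluating coordinate j of the section after acting by the
   inverse of g; weak symmetry for that inverse turns this into another coordinate. *)
- move=> _ g /imsetP[j _ ->]; have [kappa kP] := symP g^-1%g.
  apply/imsetP; exists ((kappa^-1)%g j) => //; apply/setP=> h.
  by rewrite mem_rcoset !inE /u -perm_act_vertex kP // mxE.
- move=> i z _ zi; have [j Fj zj] := facet_separation extP uP zi.
  exists (zeros j); first exact: imset_f.
  by split=> [g gF|]; rewrite inE // Fj.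
Qed.
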